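(* Let $T$ be an ordinary numerical semigroup with $T\neq\mathbb{N}$, $I$ a non-empty set of non-negative integers, and $\emptyset\neq J\subseteq I$. Then the catenary degree of $S_J^I(T)$ is $\mathsf{c}(S_J^I(T))=3$.
   Context: $\mathbb{N}$ is the set of non-negative integers. For a non-empty set $I\subseteq\mathbb{N}$, $\mathbb{N}^{(I)}$ is the additive monoid (componentwise addition) of all sequences $(n_i)_{i\in I}$ of non-negative integers with $n_i=0$ for all but finitely many $i$; $\mathbf{0}$ is the zero sequence. An ordinary numerical semigroup is a submonoid of $\mathbb{N}$ of the form $T=\{0\}\cup(m+\mathbb{N})$ with $m$ a positive integer. For $\emptyset\ne J\subseteq I$ and $\mathbf{x}=(x_i)_{i\in I}\in\mathbb{N}^{(I)}$, put $|\mathbf{x}|_J=\sum_{j\in J}x_j$, and define the submonoid $S_J^I(T)=\{\mathbf{x}\in\mathbb{N}^{(I)}:|\mathbf{x}|_J\in T\setminus\{0\}\}\cup\{\mathbf{0}\}$ of $\mathbb{N}^{(I)}$. For a submonoid $S$ of $\mathbb{N}^{(I)}$, $S^*=S\setminus\{\mathbf{0}\}$ and $\mathcal{A}(S)=S^*\setminus(S^*+S^* )$ is the set of atoms. For $\mathbf{s}\in S$, the set of factorizations of $\mathbf{s}$ is $\mathsf{Z}(\mathbf{s})=\{(\lambda_{\mathbf{a}})_{\mathbf{a}\in\mathcal{A}(S)}\in\mathbb{N}^{(\mathcal{A}(S))}:\sum_{\mathbf{a}}\lambda_{\mathbf{a}}\mathbf{a}=\mathbf{s}\}$ (finitely supported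 families). For $\mathbf{u}=(\lambda_{\mathbf{a}})$, $\mathbf{v}=(\mu_{\mathbf{a}})$ in $\mathbb{N}^{(\mathcal{A}(S))}$, put $|\mathbf{u}|=\sum_{\mathbf{a}}\lambda_{\mathbf{a}}$, let $\mathbf{u}\wedge\mathbf{v}=(\min(\lambda_{\mathbf{a}},\mu_{\mathbf{a}}))_{\mathbf{a}}$, and $\operatorname{d}(\mathbf{u},\mathbf{v})=\max\{|\mathbf{u}-(\mathbf{u}\wedge\mathbf{v})|,|\mathbf{v}-(\mathbf{u}\wedge\mathbf{v})|\}$. For $\mathbf{u},\mathbf{v}\in\mathsf{Z}(\mathbf{s})$, an $N$-chain joining them is a sequence $\mathbf{u}_1=\mathbf{u},\dots,\mathbf{u}_n=\mathbf{v}$ in $\mathsf{Z}(\mathbf{s})$ with $\operatorname{d}(\mathbf{u}_i,\mathbf{u}_{i+1})\le N$ for all $i\in\{1,\dots,n-1\}$. The catenary degree $\mathsf{c}(\mathbf{s})$ is the minimum positive integer $N$ such that any two factorizations of $\mathbf{s}$ are joined by an $N$-chain, and $\mathsf{c}(S)=\sup\{\mathsf{c}(\mathbf{s}):\mathbf{s}\in S\}$. *)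

(* Defs.v *)
From HB Require Import structures.
From mathcomp Require Import all_boot all_order all_algebra finmap multiset.
From mathcomp Require Import boolp classical_sets constructive_ereal.

Set Implicit Arguments.
Unset Strict Implicit.
Unset Printing Implicit Defensive.

Import Order.TTheory GRing.Theory Num.Theory.

Local Open Scope fset_scope.
Local Open Scope mset_scope.
Local Open Scope classical_set_scope.
Local Open Scope nat_scope.

Definition ordinary (T : set nat) : Prop :=
  exists2 m : nat, 0 < m & T = [set 0] `|` [set m + n | n in [set: nat]].

(* {mset K} is the type of finitely supported functions K -> nat, with `+` the
   pointwise sum, `\` the pointwise (truncated) difference and `&` the pointwise
   minimum: it encodes the free commutative monoid N^(K), for K = I (a set of
   natural numbers, coerced to its subtype) as well as for K = the set of atoms. *)
Definition weight (I J : set nat) (x : {mset I}) : nat :=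
  \sum_(i <- finsupp x | \val i \in J) x i.

Definition SJ (I J T : set nat) : set {mset I} :=
  [set x | (T `\ 0) (weight J x)] `|` [set mset0].
Arguments SJ : clear implicits.

Section CatenaryDegree.
Variable K : choiceType.
Implicit Types (S : set {mset K}) (s : {mset K}).

Definition atoms S : set {mset K} :=
  (S `\ mset0) `\` [set (x `+` y)%mset | x in S `\ mset0 & y in S `\ mset0].

Definition factorizations S s : set {mset (atoms S)} :=
  [set u : {mset (atoms S)} | forall i : K,
    \sum_(a <- finsupp u) u a * \val a i = s i].

(* The coercion of a multiset to a sequence repeats its elements, so
   size is the sum of the multiplicities. *)
Definition distance (A : choiceType) (u v : {mset A}) : nat :=
  maxn (size (u `\` (u `&` v))%mset) (size (v `\` (u `&` v))%mset).

Definition chained S s (N : nat) (u v : {mset (atoms S)}) : Prop :=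
  exists p : seq {mset (atoms S)},
    [/\ forall w, w \in u :: p -> factorizations s w,
        path (fun w w' => distance w w' <= N) u p &
        last u p = v].

Definition chain_bounds S s : set nat :=
  [set N | 0 < N /\ forall u v : {mset (atoms S)},
     factorizations s u -> factorizations s v -> chained s N u v].

(* In \bar int every nonempty set has a supremum and an infimum, so the default
   values of infimum and supremum are used on the empty set only. *)
Definition local_catenary_degree S s : \bar int :=
  infimum +oo%E [set (Posz N)%:E | N in chain_bounds S s].

Definition catenary_degree S : \bar int :=
  supremum -oo%E [set local_catenary_degree S s | s in S].

Lemma local_catenary_degree_min S s N :
  chain_bounds S s N -> (forall M, chain_bounds S s M -> N <= M) ->
  local_catenary_degree S s = (Posz N)%:E.
Proof.
move=> SN minN.
have NA : [set (Posz M)%:E | M in chain_bounds S s] (Posz N)%:E by exists N.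
rewrite /local_catenary_degree /infimum ifF; last first.
  by apply/eqP => A0; move: NA; rewrite A0.
have infN : infimums [set (Posz M)%:E | M in chain_bounds S s] (Posz N)%:E.
  split=> [_ [M SM <-]|y]; last exact.
  by rewrite lee_fin lez_nat; exact: minN.
by case: xgetP => [y _ iy|/(_ _ infN)//]; exact: (is_subset1_infimums iy infN).
Qed.

Lemma local_catenary_degree_infty S s :
  chain_bounds S s = set0 -> local_catenary_degree S s = +oo%E.
Proof. by move=> h; rewrite /local_catenary_degree h image_set0 /infimum eqxx. Qed.

End CatenaryDegree.

(* Main.v *)
(* In S = SJ I J T with T = {0} U (m + N), the atoms are the x with
   m <= |x|_J <= 2m - 1, so every x with m <= |x|_J <= 3m - 2 has a factorization
   of length at most 2.

   Upper bound: let a be an atom with |a|_J = m and a <= s.  Every factorization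
   of s of length at least 2 is joined by a 3-chain to one containing a: given
   two of its atoms b and c, extend the part of a lying below b + c to some
   z <= b + c with |z|_J = m; since b + c - z has a factorization of length at
   most 2, replacing b, c by z and that factorization is a step of distance at
   most 3, and one continues with z and the remaining atoms.  Cancelling a common
   atom a, one concludes by induction on |s|_J.

   Lower bound: for e a unit vector at an index of J, me + me + me is a
   factorization of 3me which has no atom in common with any other one, and
   (m+1)e + (2m-1)e is another one. *)
Require Import Defs.
From mathcomp Require Import all_boot all_order all_algebra.
From mathcomp Require Import finmap multiset.
From mathcomp Require Import boolp classical_sets constructive_ereal.
From mathcomp Require Import zify.
Local Open Scope classical_set_scope.

Set Implicit Arguments.
Unset Strict Implicit.
Unset Printing Implicit Defensive.

(** * Finite multisets: induction, sums, sizes and distance *)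

Section Multisets.
Local Open Scope fset_scope.
Local Open Scope mset_scope.
Local Open Scope nat_scope.
Variable K : choiceType.
Implicit Types x y z : {mset K}.

Lemma mset_ind (P : {mset K} -> Prop) :
  P mset0 -> (forall a x, P x -> P (a +` x)) -> forall x, P x.
Proof.
move=> P0 PS x; rewrite -(seq_mset_id x).
elim: (x : seq K) => [|a s IH]; last by rewrite mset_cons; exact: PS.
by rewrite (_ : seq_mset [::] = mset0)//; apply/msetP => a; rewrite mset_seqE mset0E.
Qed.

Lemma perm_msetD x y : perm_eq (x `+` y) (x ++ y).
Proof.
by rewrite /perm_eq; apply/allP => a _ /=; rewrite count_cat !count_mem_mset msetE2.
Qed.

Lemma sum_msetD (F : K -> nat) x y :
  \sum_(a <- x `+` y) F a = \sum_(a <- x) F a + \sum_(a <- y) F a.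
Proof. by rewrite (perm_big _ (perm_msetD x y)) big_cat. Qed.

Lemma sum_mset1 (F : K -> nat) a : \sum_(b <- [mset a]) F b = F a.
Proof. by rewrite enum_msetn big_seq1. Qed.

Lemma size_msetD x y : size (x `+` y) = size x + size y.
Proof. by rewrite (perm_size (perm_msetD x y)) size_cat. Qed.

Lemma size_mset1 (a : K) : size [mset a] = 1.
Proof. by rewrite enum_msetn. Qed.

Lemma size_mset1D a x : size (a +` x) = (size x).+1.
Proof. by rewrite size_msetD size_mset1. Qed.

Lemma mset_sizeS x n : size x = n.+1 -> exists a y, x = a +` y /\ size y = n.
Proof.
elim/mset_ind: x => [|a y _]; first by rewrite size_mset0.
by rewrite size_mset1D => -[yn]; exists a, y.
Qed.

Lemma msubset_size x y : x `<=` y -> size x <= size y.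
Proof. by move=> /msetBDKC <-; rewrite size_msetD leq_addr. Qed.

Lemma distanceC x y : distance x y = distance y x.
Proof. by rewrite /distance msetIC maxnC. Qed.

Lemma distanceDr x y z : distance (x `+` z) (y `+` z) = distance x y.
Proof. by rewrite /distance -msetDIl !msetBDr. Qed.

Lemma distance_le_size x y : distance x y <= maxn (size x) (size y).
Proof.
have sizeB z t : size (z `\` t) <= size z.
  by apply/msubset_size/msubsetP => a; rewrite msetE2 leq_subr.
by rewrite geq_max !leq_max !sizeB orbT.
Qed.

End Multisets.

(** * Factorizations and chains over an arbitrary set [S] *)

Section Chains.
Local Open Scope fset_scope.
Local Open Scope mset_scope.
Local Open Scope nat_scope.
Variables (K : choiceType) (S : set {mset K}).
Implicit Types (s t : {mset K}) (u v w : {mset (atoms S)}).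

Lemma factorizationsE s u :
  factorizations s u <-> forall i, \sum_(a <- u) \val a i = s i.
Proof. by split=> h i; have := h i; rewrite sum_mset. Qed.

Lemma factorizations0 : factorizations (mset0 : {mset K}) (mset0 : {mset (atoms S)}).
Proof. by apply/factorizationsE => i; rewrite enum_mset0 big_nil mset0E. Qed.

(* A fixed elaboration of \val: lia does not identify convertible variants. *)
Definition atomv (a : atoms S) : {mset K} := \val a.

Lemma factorizations1 (a : atoms S) : factorizations (atomv a) [mset a].
Proof. by apply/factorizationsE => i; rewrite sum_mset1. Qed.

Lemma factorizationsD s t u v :
  factorizations s u -> factorizations t v -> factorizations (s `+` t) (u `+` v).
Proof.
move=> /factorizationsE su /factorizationsE tv; apply/factorizationsE => i.
by rewrite sum_msetD su tv msetE2.
Qed.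

Lemma factorizations_uniq s t u : factorizations s u -> factorizations t u -> s = t.
Proof.
move=> /factorizationsE su /factorizationsE tu.
by apply/msetP => i; rewrite -su tu.
Qed.

Lemma factorizations_ex u : exists s, factorizations s u.
Proof.
elim/mset_ind: u => [|a u [s su]]; first by exists mset0; exact: factorizations0.
by exists (atomv a `+` s); exact: factorizationsD (factorizations1 a) su.
Qed.

(** The cofactor [t] is the sum of the atoms in [u]; a multiset of atoms factors only one element,
    which identifies [s]. *)
Lemma factorizations_cons s (a : atoms S) u : factorizations s (a +` u) ->
  exists2 t, s = atomv a `+` t & factorizations t u.
Proof.
move=> sau; have [t tu] := factorizations_ex u; exists t => //.
exact: factorizations_uniq sau (factorizationsD (factorizations1 a) tu).
Qed.

Variable N : nat.

Lemma chained_distance s u v : factorizations s u -> factorizations s v ->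
  distance u v <= N -> chained s N u v.
Proof.
move=> su sv uv; exists [:: v]; split => //=; last by rewrite uv.
by move=> w; rewrite !inE => /orP[] /eqP ->.
Qed.

Lemma chained_size s u v : factorizations s u -> factorizations s v ->
  size u <= N -> size v <= N -> chained s N u v.
Proof.
move=> su sv uN vN; apply: chained_distance => //.
by apply: leq_trans (distance_le_size u v) _; rewrite geq_max uN.
Qed.

Lemma chained_trans s v u w : chained s N u v -> chained s N v w -> chained s N u w.
Proof.
move=> [p [sp pN pv]] [q [sq qN qw]]; exists (p ++ q); split.
- move=> x; rewrite -cat_cons mem_cat => /orP[/sp//|xq].
  by apply: sq; rewrite inE xq orbT.
- by rewrite cat_path pN pv.
- by rewrite last_cat pv.
Qed.

Lemma chained_sym s u v : chained s N u v -> chained s N v u.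
Proof.
move=> [p [sp pN <-]]; exists (rev (belast u p)); split.
- move=> w; rewrite -rev_rcons -lastI mem_rev; exact: sp.
- by rewrite rev_path; under eq_path => x y do rewrite /= distanceC.
- by case: p {sp pN} => //= a p; rewrite rev_cons last_rcons.
Qed.

(** Distance is translation invariant, so a chain for part of an element acts inside a longer
    factorization. *)
Lemma chainedDr s t u v w : chained s N u v -> factorizations t w ->
  chained (s `+` t) N (u `+` w) (v `+` w).
Proof.
move=> [p [sp pN <-]] tw; exists (map (fun x => x `+` w) p); split.
- rewrite -(map_cons (fun x => x `+` w)) => _ /mapP[x /sp sx ->].
  exact: factorizationsD.
- rewrite (@path_map _ _ (fun x => x `+` w)).
  by under eq_path => x y do rewrite /= distanceDr.
- exact: (last_map (fun x => x `+` w)).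
Qed.


(** The uniform bound [N] makes every local degree a minimum of natural numbers, at most [N]; at [s]
    it equals [N], so the supremum is attained. *)
Lemma catenary_degree_eq s :
  (forall t, S t -> chain_bounds S t N) ->
  S s -> (forall M, chain_bounds S s M -> N <= M) ->
  catenary_degree S = (Posz N)%:E.
Proof.
move=> SN Ss minN.
have sN := local_catenary_degree_min (SN s Ss) minN.
have NA : [set local_catenary_degree S t | t in S] (Posz N)%:E by exists s.
rewrite /catenary_degree /supremum ifF; last first.
  by apply/eqP => A0; move: NA; rewrite A0.
have supN : supremums [set local_catenary_degree S t | t in S] (Posz N)%:E.
  split=> [_ [t St <-]|y]; last exact.
  have exM : exists M, `[< chain_bounds S t M >] by exists N; apply/asboolP/SN.
  have [M /asboolP tM minM] := ex_minnP exM.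
  rewrite (local_catenary_degree_min tM) => [|M' tM']; last exact/minM/asboolP.
  by rewrite lee_fin lez_nat; apply/minM/asboolP/SN.
by case: xgetP => [y _ iy|/(_ _ supN)//]; exact: (is_subset1_supremums iy supN).
Qed.

End Chains.

(** * Weights, atoms and lengths in the monoid defined by [m] *)

Section Ordinary.
Local Open Scope fset_scope.
Local Open Scope mset_scope.
Local Open Scope nat_scope.
Variables (K : choiceType) (P : pred K) (m : nat) (S : set {mset K}).

(** When [P] is membership in [J] this is [|x|_J], since the sequence of a multiset repeats its
    elements. *)
Definition pweight (x : {mset K}) : nat := count P x.

Hypothesis m_gt0 : 0 < m.
Hypothesis SE : forall x, S x <-> m <= pweight x \/ x = mset0.
Implicit Types (x y z s t : {mset K}) (a b c : atoms S) (u v w : {mset (atoms S)}).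

Lemma pweightD x y : pweight (x `+` y) = pweight x + pweight y.
Proof. by rewrite /pweight (permP (perm_msetD x y)) count_cat. Qed.

Lemma pweight0 : pweight (mset0 : {mset K}) = 0.
Proof. by rewrite /pweight enum_mset0. Qed.

Lemma pweightn n i : P i -> pweight (msetn n i) = n.
Proof. by move=> Pi; rewrite /pweight enum_msetn count_nseq Pi mul1n. Qed.

Lemma pweightB x y : x `<=` y -> pweight y = pweight x + pweight (y `\` x).
Proof. by move=> xy; rewrite -pweightD msetBDKC. Qed.

Lemma pweight_gt0P x : 0 < pweight x -> exists i, i \in x /\ P i.
Proof. by rewrite -has_count => /hasP[i ix Pi]; exists i. Qed.

(** Elements of [y] satisfying [P] are added to [x] one at a time, each raising the weight by
    exactly one. *)
Lemma interpolation k x y : x `<=` y -> pweight x <= k -> k <= pweight y ->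
  exists z, [/\ x `<=` z, z `<=` y & pweight z = k].
Proof.
move=> xy xk ky; elim: k xk ky => [|k IH] xk ky.
  by exists x; split => //; [exact: msubset_refl | lia].
have [{}xk|kx] := leqP (pweight x) k; last first.
  by exists x; split => //; [exact: msubset_refl | lia].
have [z [xz zy zk]] := IH xk (ltnW ky).
have [|i [iyz Pi]] := @pweight_gt0P (y `\` z).
  by move: (pweightB zy); lia.
exists (i +` z); split.
- by apply/msubsetP => j; rewrite mset1DE; move/msubsetP/(_ j): xz; lia.
- rewrite -(msetBDKC zy) msetDC; apply: msetDS.
  by rewrite msub1set.
- by rewrite pweightD pweightn// zk add1n.
Qed.

Lemma submset_weight k x : k <= pweight x -> exists2 z, z `<=` x & pweight z = k.
Proof.
move=> kx; have [||z [_ zx zk]] := @interpolation k mset0 x _ _ kx.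
- exact: msub0set.
- by rewrite pweight0.
- by exists z.
Qed.

Lemma SN0_pweight x : S x -> x <> mset0 -> m <= pweight x.
Proof. by move=> /SE[]. Qed.

Lemma pweight_SN0 x : m <= pweight x -> (S `\ mset0)%classic x.
Proof.
move=> mx; split; first by apply/SE; left.
by move=> /= x0; move: mx; rewrite x0 pweight0 leqNgt m_gt0.
Qed.

(** From weight [2m] on, a part of weight exactly [m] splits off and leaves weight at least [m];
    conversely, two nonzero summands weigh at least [2m] together. *)
Lemma atomsE x : atoms S x <-> m <= pweight x < m.*2.
Proof.
split=> [[[Sx x0] /= nx]|/andP[mx xm]].
  have mx := SN0_pweight Sx x0; rewrite mx ltnNge /=; apply/negP => m2x.
  have [z zx zm] := submset_weight mx.
  apply: nx; have := pweightB zx => wx.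
  exists z; first by apply: pweight_SN0; rewrite zm.
  exists (x `\` z); first by apply: pweight_SN0; lia.
  by rewrite msetBDKC.
split; first exact: pweight_SN0.
move=> [y [Sy y0] [z [Sz z0] yzx]]; move: xm; rewrite -yzx pweightD.
by have := SN0_pweight Sy y0; have := SN0_pweight Sz z0; lia.
Qed.

Lemma atom_weight a : m <= pweight (atomv a) < m.*2.
Proof. by apply/atomsE; exact: set_mem (valP a). Qed.

Lemma atom_ex x : m <= pweight x < m.*2 -> exists a, atomv a = x.
Proof. by move=> /atomsE /mem_set ax; exists (Sub x ax); rewrite /atomv SubK. Qed.

Lemma factorizations_size s u : factorizations s u ->
  m * size u <= pweight s <= (m.*2).-1 * size u.
Proof.
elim/mset_ind: u s => [|a u IH] s.
  move=> /(factorizations_uniq (factorizations0 S)) <-.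
  by rewrite size_mset0 !muln0 pweight0.
move=> /factorizations_cons[t -> /IH].
rewrite size_msetD size_mset1 pweightD; have := atom_weight a; nia.
Qed.

(** If [x] is not an atom, removing an atom of weight [m] leaves weight between [m] and [2m - 2].
    The bound fits what remains of two atoms after removing weight [m]: at most
    [2(2m - 1) - m = 3m - 2]. *)
Lemma factorizations_short x : m <= pweight x -> pweight x < 3 * m - 1 ->
  exists2 u : {mset (atoms S)}, factorizations x u & size u <= 2.
Proof.
move=> mx xm; have [x2m|m2x] := ltnP (pweight x) m.*2.
  have [|a <-] := @atom_ex x; first by rewrite mx.
  by exists [mset a]; [exact: factorizations1 | rewrite size_mset1].
have [z zx zm] := submset_weight mx.
have [|a az] := @atom_ex z; first by lia.
have [|b bxz] := @atom_ex (x `\` z); first by move: (pweightB zx); lia.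
exists ([mset a] `+` [mset b]); last by rewrite size_msetD !size_mset1.
by rewrite -(msetBDKC zx) -bxz -az; apply: factorizationsD; exact: factorizations1.
Qed.

(** * Upper bound: 3-chains between factorizations *)

Lemma chained_to_atom s u a : factorizations s u -> 1 < size u ->
  atomv a `<=` s -> pweight (atomv a) = m -> exists v, chained s 3 u (a +` v).
Proof.
move=> + u1; have [n un] : exists n, size u = n.+2.
  by exists (size u).-2; case: (size u) u1 => [|[]].
elim/ltn_ind: n s u {u1} un => n IH s u un su as_ am.
have [b [u1 [ub un1]]] := mset_sizeS un.
have [c [u' [uc un']]] := mset_sizeS un1.
move: un un1 => _ _; subst u1 u.
move: su => /factorizations_cons[s1 ss1 /factorizations_cons[t s1t tu']].
subst s1 s.
move: (atom_weight b) (atom_weight c) => wb wc.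
set y := atomv b `+` atomv c.
have wy : pweight y = pweight (atomv b) + pweight (atomv c) by rewrite pweightD.
have bc : factorizations y (b +` [mset c]).
  exact: factorizationsD (factorizations1 b) (factorizations1 c).
case: n IH un' => [|n] IH un'.
  have u'E : u' = mset0 by apply/eqP; rewrite -size_mset_eq0 un'.
  have tE : t = mset0.
    by apply/esym/(factorizations_uniq (factorizations0 S)); rewrite -u'E.
  rewrite u'E tE !msetD0 -/y in as_ *.
  have [||v yv v2] := @factorizations_short (y `\` atomv a).
  - by move: (pweightB as_); lia.
  - by move: (pweightB as_); lia.
  exists v; apply: chained_size => //.
  - by rewrite -(msetBDKC as_); exact: factorizationsD (factorizations1 a) yv.
  - by rewrite size_msetD !size_mset1.
  - by rewrite size_msetD size_mset1; lia.
(* z absorbs the part of a lying in b + c, so that a <= z + t and z replaces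
   two atoms of the factorization by one. *)
have [||| z [az zy zm]] := @interpolation m (atomv a `&` y) y.
- by apply/msubsetP => i; rewrite msetE2 geq_minr.
- rewrite -am (@pweightB (atomv a `&` y) (atomv a)) ?leq_addr//.
  by apply/msubsetP => i; rewrite msetE2 geq_minl.
- by lia.
have [|b' b'z] := @atom_ex z; first by lia.
have [||r yr r2] := @factorizations_short (y `\` z).
- by move: (pweightB zy); lia.
- by move: (pweightB zy); lia.
have b'r : factorizations y (b' +` r).
  by rewrite -(msetBDKC zy) -{1}b'z; exact: factorizationsD (factorizations1 b') yr.
have ch1 : chained (y `+` t) 3 (b +` [mset c] `+` u') (b' +` r `+` u').
  apply: chainedDr => //; apply: chained_size => //.
    by rewrite size_msetD !size_mset1.
  by rewrite size_msetD size_mset1; lia.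
(* The factorization [r] is set aside: [b' + u'] is one atom shorter than the original, and [r] is
   added back along the resulting chain. *)
have [|||||v ch2] := IH n _ (z `+` t) (b' +` u').
- by [].
- by rewrite size_mset1D un'.
- by rewrite -b'z; exact: factorizationsD (factorizations1 b') tu'.
(* If [a_i <= y_i] then [a_i <= z_i]; otherwise [y_i <= z_i], and [a <= y + t] concludes. *)
- apply/msubsetP => i; move/msubsetP/(_ i): as_; move/msubsetP/(_ i): az.
  by rewrite /y !msetE2; lia.
- exact: am.
exists (v `+` r); rewrite !msetDA -/y.
apply: chained_trans ch1 _.
rewrite msetDAC -(msetBDKC zy) msetDAC; exact: chainedDr ch2 yr.
Qed.

Lemma chained3 s u v : factorizations s u -> factorizations s v -> chained s 3 u v.
Proof.
have [n] := ubnP (pweight s); elim: n s u v => // n IH s u v sn su sv.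
have [sm|ms] := ltnP (pweight s) m.*2.
  have small w : factorizations s w -> size w <= 3.
    by move=> /factorizations_size; nia.
  by apply: chained_size => //; exact: small.
(* A single atom weighs at most [2m - 1]. *)
have large w : factorizations s w -> 1 < size w.
  by move=> /factorizations_size; nia.
have [|x xs xm] := @submset_weight m s; first by lia.
have [|a ax] := @atom_ex x; first by lia.
subst x.
have [u' uu'] := chained_to_atom su (large _ su) xs xm.
have [v' vv'] := chained_to_atom sv (large _ sv) xs xm.
(* The end of a chain is itself a factorization of [s], so its atom [a] can be cancelled. *)
have cut w w' : chained s 3 w (a +` w') -> factorizations (s `\` atomv a) w'.
  move=> [p [sp _ pw]]; have := sp (a +` w'); rewrite -pw mem_last => /(_ isT).
  by rewrite pw => /factorizations_cons[t -> ?]; rewrite msetDKB.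
apply: (chained_trans uu' (chained_trans _ (chained_sym vv'))).
rewrite -(msetBDK xs) !(msetDC [mset a]); apply: chainedDr (factorizations1 a).
apply: IH; [by move: (pweightB xs); lia | exact: cut uu' | exact: cut vv'].
Qed.

Lemma chain_bounds3 s : chain_bounds S s 3.
Proof. by split=> // u v; exact: chained3. Qed.

(** * Lower bound: an isolated factorization *)

Lemma factorizations_msetn_double j a u : P j -> atomv a = msetn m j ->
  factorizations (msetn m.*2 j) u -> u = a +` [mset a].
Proof.
move=> Pj aj su.
(* Atoms weigh at least [m] and less than [2m]; with total weight [2m] there are exactly two, each
   of weight [m]. *)
have u2 : size u = 2.
  by have := factorizations_size su; rewrite pweightn//; nia.
have [d [u' [ud u1]]] := mset_sizeS u2.
have [e [u'' [ue /eqP]]] := mset_sizeS u1.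
rewrite size_mset_eq0 => /eqP u0.
move: u2 u1 => _ _; subst u u' u''; rewrite msetD0 in su *.
move: su => /factorizations_cons[t tE].
move=> /(factorizations_uniq (factorizations1 e)) et; subst t.
have wde : pweight (atomv d) + pweight (atomv e) = m.*2.
  by rewrite -pweightD -tE pweightn.
(* An atom supported at [j] alone is determined by its weight. *)
have fa f : atomv f `<=` msetn m.*2 j -> pweight (atomv f) = m -> f = a.
  move=> fj fm; apply: val_inj; rewrite -/(atomv f) -/(atomv a) aj.
  have fE : atomv f = msetn (atomv f j) j.
    apply/msetP => k; move/msubsetP/(_ k): fj; rewrite !msetnE.
    by case: eqP => [->//|_]; rewrite leqn0 => /eqP.
  by rewrite fE -fm {2}fE pweightn.
have wd := atom_weight d; have we := atom_weight e.
have da : d = a.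
  by apply: fa; [apply/msubsetP => i; rewrite tE msetE2 leq_addr | lia].
have ea : e = a.
  by apply: fa; [apply/msubsetP => i; rewrite tE msetE2 leq_addl | lia].
by rewrite da ea.
Qed.

Lemma chain_bound_ge3 (j : K) N : 1 < m -> P j ->
  chain_bounds S (msetn (3 * m) j) N -> 3 <= N.
Proof.
move=> m1 Pj [_ chN].
have msetnD k l : msetn k j `+` msetn l j = msetn (k + l) j.
  by apply/msetP => i; rewrite msetE2 !msetnE; case: eqP.
have [|a aj] := @atom_ex (msetn m j); first by rewrite pweightn//; lia.
(* Here [1 < m] is essential: it gives [m + 1 < 2m]. *)
have [|b bj] := @atom_ex (msetn m.+1 j); first by rewrite pweightn//; lia.
have [|c cj] := @atom_ex (msetn (m.*2).-1 j); first by rewrite pweightn//; lia.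
pose u := a +` (a +` [mset a]).
pose v := b +` [mset c].
have su : factorizations (msetn (3 * m) j) u.
  rewrite (_ : 3 * m = m + (m + m)) -?msetnD -?aj; last by lia.
  by do 2!apply: factorizationsD (factorizations1 a) _; exact: factorizations1.
have sv : factorizations (msetn (3 * m) j) v.
  rewrite (_ : 3 * m = m.+1 + (m.*2).-1) -?msetnD -?bj -?cj; last by lia.
  exact: factorizationsD (factorizations1 b) (factorizations1 c).
(* Removing one [a] leaves a factorization of [2m] copies of [j], which is unique. *)
have onlyu w : factorizations (msetn (3 * m) j) w -> a \in w -> w = u.
  move=> sw aw; rewrite -(msetB1K aw) in sw *; move: (w `\ a) sw => {aw}w.
  move=> /factorizations_cons[t tE tw].
  have tj : t = msetn m.*2 j.
    rewrite -[LHS](@msetDKB _ (atomv a)) -tE aj.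
    by apply/msetP => i; rewrite msetE2 !msetnE; case: eqP => _; lia.
  by rewrite tj in tw; rewrite (factorizations_msetn_double Pj aj tw).
have u3 : size u = 3 by rewrite size_mset1D size_mset1D size_mset1.
have far w : factorizations (msetn (3 * m) j) w -> w <> u -> 3 <= distance u w.
  move=> sw wu; have aw : a \notin w by apply/negP => /(onlyu _ sw).
  rewrite /distance (_ : u `&` w = mset0); last first.
    apply/msetP => d; rewrite msetE2 mset0E /u !mset1DE msetnE.
    case: eqP => [->|]; first by rewrite (mset_eq0P aw) minn0.
    by rewrite !add0n min0n.
  by rewrite msetB0 leq_max u3.
have [p [sp pN pv]] := chN u v su sv.
have v2 : size v = 2 by rewrite size_mset1D size_mset1.
have vu : v <> u by move=> vu; move: v2; rewrite vu u3.
(* Steps that stay at [u] are skipped; the first step leaving [u] has distance at least 3. *)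
elim: p sp pN pv => [|w p IH] /= sp; first by move=> _ /esym.
case/andP=> uwN pN pv; have [wu|/eqP wu] := eqVneq w u.
  subst w; by apply: IH => // x xp; apply: sp; rewrite inE xp orbT.
by apply: leq_trans uwN; apply: far => //; apply: sp; rewrite !inE eqxx orbT.
Qed.

End Ordinary.

(** * Specialization to [SJ I J T] *)

Theorem proposition7p8 (T I J : set nat) (hT : ordinary T)
    (hTN : T <> [set: nat]) (hI : I !=set0) (hJ : J !=set0) (hJI : J `<=` I) :
  catenary_degree (SJ I J T) = 3%E.
Proof.
have weightE (x : {mset I}%mset) : weight J x = pweight (fun i => \val i \in J) x.
  rewrite /pweight -sum1_count sum_mset /weight; apply: eq_bigr => i _.
  by rewrite muln1.
case: hT hTN => m m_gt0 TE TN.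
(* For [m = 1] the semigroup would be all of the natural numbers. *)
have m1 : (1 < m)%N.
  rewrite ltn_neqAle m_gt0 andbT; apply/eqP => m1; apply: TN.
  rewrite TE -m1; apply/seteqP; split=> // -[|n] _; first by left.
  by right; exists n.
have SE x : SJ I J T x <-> (m <= pweight (fun i => \val i \in J) x)%N \/ x = mset0.
  rewrite -weightE /SJ TE /=.
  split=> [[[[//|[n _ <-]] _]|->]|[mx|->]]; [|by right| |by right].
    by left; rewrite leq_addr.
  left; split; last by move: mx; case: (weight J x) => //; lia.
  by right; exists (weight J x - m)%N => //; lia.
have [j Jj] := hJ.
pose i : I := Sub j (mem_set (hJI j Jj)).
have iJ : \val i \in J by rewrite SubK; exact: mem_set.
apply: (@catenary_degree_eq _ _ 3 (msetn (3 * m) i)).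
- by move=> t _; exact: chain_bounds3 m_gt0 SE t.
- apply/SE; left; rewrite pweightn //; lia.
- by move=> N; exact: chain_bound_ge3 m_gt0 SE i N m1 iJ.
Qed.
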